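(* Suppose that $X$ is a Fréchet sequence space over $\mathbb{Z}$ in which the sequence $(e_n)_{n\in\mathbb{Z}}$ of canonical vectors is a basis, $(\|\cdot\|_k)_{k\in\mathbb{N}}$ is an increasing sequence of seminorms that induces the topology of $X$, $w=(w_n)_{n\in\mathbb{Z}}$ is a sequence of nonzero scalars, and the bilateral weighted forward shift $F_w$ is an invertible operator on $X$. Then the following assertions are equivalent: (i) $F_w:X\to X$ is topologically expansive; (ii) there exists $k\in\mathbb{N}$ such that (a) $\sup_{n\in\mathbb{N}}|w_1\cdots w_n|\,\|e_{n+1}\|_k=\infty$, or (b) $\sup_{n\in\mathbb{N}}|w_{-n+1}\cdots w_0|^{-1}\,\|e_{-n+1}\|_k=\infty$; (iii) (a) $F_w:X\to X$ is topologically positively expansive, or (b) $F_w^{-1}:X\to X$ is topologically positively expansive.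
   Context: $\mathbb{K}$ is $\mathbb{R}$ or $\mathbb{C}$; $\mathbb{N}=\{1,2,\dots\}$. $\omega(\mathbb{Z})=\mathbb{K}^{\mathbb{Z}}$ is the Fréchet space of all scalar sequences with the product topology. A Fréchet sequence space over $\mathbb{Z}$ is a subspace $X$ of $\omega(\mathbb{Z})$ equipped with a topology under which $X$ is a Fréchet space (a complete metrizable locally convex space) and the embedding $X\hookrightarrow\omega(\mathbb{Z})$ is continuous. The canonical vectors are $e_n=(\delta_{j,n})_{j\in\mathbb{Z}}$; they form a basis in $X$ if they belong to $X$ and every $x=(x_n)_{n\in\mathbb{Z}}\in X$ satisfies $x=\lim_{m,n\to\infty}\sum_{j=-m}^{n}x_je_j$ in $X$. The bilateral weighted forward shift is $F_w((x_n)_{n\in\mathbb{Z}}):=(w_{n-1}x_{n-1})_{n\in\mathbb{Z}}$. ''$F_w$ is an invertible operator on $X$'' means that $F_w$ maps $X$ into itself and $F_w:X\to X$ is a continuous linear operator with a continuous inverse. An invertible operator $T$ on $X$ is topologically expansive if for each nonzero $x\in X$ there exists $k\in\mathbb{N}$ with $\sup_{n\in\mathbb{Z}}\|T^nx\|_k=\infty$. A continuous linear operator $T$ on $X$ is topologically positively expansive if for each nonzero $x\in X$ there exists $k\in\mathbb{N}$ with $\sup_{n\in\mathbb{N}}\|T^nx\|_k=\infty$. *)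

(* Defs.v *)
From HB Require Import structures.
From mathcomp Require Import all_boot all_order all_algebra.
From mathcomp Require Import all_classical all_reals all_analysis.
From mathcomp Require Import complex.

Set Implicit Arguments.
Unset Strict Implicit.
Unset Printing Implicit Defensive.

Import Order.TTheory GRing.Theory Num.Theory.
Import numFieldNormedType.Exports.

Local Open Scope classical_set_scope.
Local Open Scope ring_scope.

Variant scalar_kind := RealScalars | ComplexScalars.

Definition scalar_field (R : realType) (s : scalar_kind) : numFieldType :=
  match s with RealScalars => R | ComplexScalars => R[i] end.

(* MathComp's norm on [R[i]] takes its values in [R[i]]; seminorms here are
   real-valued, so the modulus has to be real-valued too. *)
Definition modulus (R : realType) (s : scalar_kind) : scalar_field R s -> R :=
  match s with
  | RealScalars => fun x : R => `|x|
  | ComplexScalars => fun x : R[i] => ComplexField.Normc.normc x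
  end.

(* A linear subspace [S] of [V] carrying a locally convex vector topology of its
   own, not related to any topology on [V]. *)
#[short(type="subTvsType")]
HB.structure Definition SubTvs (K : numFieldType) (V : lmodType K)
    (S : pred V) := {U of @GRing.SubLmodule K V S U & Tvs K U}.

Definition metrizable (R : realType) (T : topologicalType) : Prop :=
  exists d : T -> T -> R,
    [/\ forall x y, (d x y == 0) = (x == y),
        forall x y, d x y = d y x,
        forall x y z, d x z <= d x y + d y z &
        forall x (A : set T),
          nbhs x A <-> exists2 r : R, 0 < r & [set y | d x y < r] `<=` A].

(* A [tvsType] comes with some uniformity that induces its topology, which need
   not be the translation-invariant one; Cauchy filters are therefore expressed
   through the neighbourhoods of 0 and not through [entourage]. *)
Definition complete_tvs (K : numFieldType) (X : tvsType K) : Prop :=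
  forall F : set_system X, ProperFilter F ->
    (forall U, nbhs (0 : X) U ->
       \forall xy \near filter_prod F F, U (xy.1 - xy.2)) ->
    exists x : X, F --> x.

Definition frechet_sequence_space (R : realType) (s : scalar_kind)
    (S : pred (int -> scalar_field R s)) (X : subTvsType S) : Prop :=
  [/\ metrizable R X, complete_tvs X &
      continuous (\val : X -> prod_topology (fun _ : int => scalar_field R s))].

Definition canonical_vector (K : numFieldType) (n : int) : int -> K :=
  fun j => (j == n)%:R.

(* [\sum_(j = -m)^n x_j e_j], reindexed by [j = i - m] with [0 <= i <= m + n];
   [m] and [n] tend to infinity independently. *)
Definition canonical_basis (R : realType) (s : scalar_kind)
    (S : pred (int -> scalar_field R s)) (X : subTvsType S) (e : int -> X) : Prop :=
  (forall n, \val (e n) = canonical_vector (scalar_field R s) n) /\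
  (forall x : X,
     (fun mn : nat * nat => \sum_(0 <= i < (mn.1 + mn.2).+1)
        (\val x) (i%:Z - mn.1%:Z) *: e (i%:Z - mn.1%:Z))
     @ filter_prod \oo \oo --> x).

Definition is_seminorm (R : realType) (s : scalar_kind)
    (X : lmodType (scalar_field R s)) (q : X -> R) : Prop :=
  [/\ forall x, 0 <= q x,
      forall x y, q (x + y) <= q x + q y &
      forall a x, q (a *: x) = modulus a * q x].

Definition induces_topology (R : realType) (K : numFieldType) (X : tvsType K)
    (p : nat -> X -> R) : Prop :=
  forall (x : X) (A : set X),
    nbhs x A <-> exists (ks : seq nat) (r : R), 0 < r /\
      [set y | forall k, k \in ks -> p k (y - x) < r] `<=` A.

Definition increasing_seminorms (R : realType) (s : scalar_kind)
    (X : tvsType (scalar_field R s)) (p : nat -> X -> R) : Prop :=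
  [/\ forall k, is_seminorm (p k),
      forall k x, p k x <= p k.+1 x &
      induces_topology p].

Definition forward_shift (K : numFieldType) (w x : int -> K) : int -> K :=
  fun n => w (n - 1) * x (n - 1).

Record invertible_operator (K : numFieldType) (X : tvsType K) := {
  op :> {linear X -> X};
  op_inv : X -> X;
  op_continuous : continuous op;
  op_inv_continuous : continuous op_inv;
  opK : cancel op op_inv;
  op_invK : cancel op_inv op
}.

Definition op_pow (K : numFieldType) (X : tvsType K)
    (T : invertible_operator X) (n : int) : X -> X :=
  match n with
  | Posz m => iter m T
  | Negz m => iter m.+1 (op_inv T)
  end.

Definition topologically_expansive (R : realType) (K : numFieldType)
    (X : tvsType K) (p : nat -> X -> R) (T : invertible_operator X) : Prop :=
  forall x : X, x != 0 -> exists k : nat,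
    ereal_sup [set (p k (op_pow T n x))%:E | n in [set: int]] = +oo%E.

Definition topologically_positively_expansive (R : realType)
    (K : numFieldType) (X : tvsType K) (p : nat -> X -> R) (T : X -> X) : Prop :=
  forall x : X, x != 0 -> exists k : nat,
    ereal_sup [set (p k (iter n T x))%:E | n in [set n | (0 < n)%N]] = +oo%E.

(* Main.v *)
(* If [F_w] (or its inverse) is applied n times to x, the coordinate x_j is moved
   to position j + n (or j - n) and multiplied by the same weights as in the orbit
   of e_j. The uniform boundedness principle makes the maps x |-> x_n e_n
   equicontinuous, so a bounded orbit of a vector with x_j != 0 yields a bounded
   orbit of e_j. The forward orbits of e_j and e_1 agree up to a nonzero scalar and
   finitely many terms; hence an unbounded half-orbit of e_1, which is what (ii)
   asserts, makes every nonzero half-orbit in the same direction unbounded. *)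

Require Import Defs.
From HB Require Import structures.
From mathcomp Require Import all_boot all_order all_algebra.
From mathcomp Require Import all_classical all_reals all_analysis.
From mathcomp Require Import complex lra.

Set Implicit Arguments.
Unset Strict Implicit.
Unset Printing Implicit Defensive.

Import Order.TTheory GRing.Theory Num.Theory.
Import numFieldNormedType.Exports.

Local Open Scope classical_set_scope.
Local Open Scope ring_scope.

Lemma ereal_sup_EFinP (R : realType) (T : Type) (D : set T) (f : T -> R) :
  D !=set0 ->
  ereal_sup [set (f t)%:E | t in D] = +oo%E <->
  ~ exists B, forall t, D t -> f t <= B.
Proof.
move=> D0; split=> [supE [B fB]|unbounded].
  suff : (+oo <= B%:E)%E by [].
  by rewrite -supE; apply: ge_ereal_sup => _ [t Dt <-]; rewrite lee_fin fB.
rewrite -[X in ereal_sup X](image_comp f EFin); apply: hasNub_ereal_sup.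
  by case=> B ubB; apply: unbounded; exists B => t Dt; apply: ubB; exists t.
by case: D0 => t Dt; exists (f t), t.
Qed.

(** * The real-valued modulus and seminorms *)

Section Modulus.
Variables (R : realType) (s : scalar_kind).
Implicit Types a b : scalar_field R s.

Lemma modulus0 : modulus (0 : scalar_field R s) = 0.
Proof. by case: s; [exact: normr0 | exact: ComplexField.Normc.normc0]. Qed.

Lemma modulusN1 : modulus (-1 : scalar_field R s) = 1.
Proof.
case: s => /=; first by rewrite normrN1.
by apply: etrans (@normcN R 1) _; exact: ComplexField.Normc.normc1.
Qed.

Lemma modulus_nat n : modulus (n%:R : scalar_field R s) = n%:R.
Proof.
case: s => /=; first exact: normr_nat.
by apply: etrans (@normcMn R 1 n) _; rewrite ComplexField.Normc.normc1.
Qed.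

Lemma modulusV a : modulus a^-1 = (modulus a)^-1.
Proof. by case: s a => a; [exact: normfV | exact: ComplexField.Normc.normcV]. Qed.

Lemma modulus_ge0 a : 0 <= modulus a.
Proof.
case: s a => a; first exact: normr_ge0.
by rewrite -ler0c -[X in 0 <= X]/(`|a|) normr_ge0.
Qed.

End Modulus.

Section Seminorm.
Variables (R : realType) (s : scalar_kind) (X : lmodType (scalar_field R s)).
Variables (q : X -> R) (hq : is_seminorm q).

Lemma seminorm_ge0 x : 0 <= q x.
Proof. by case: hq. Qed.

Lemma seminormD x y : q (x + y) <= q x + q y.
Proof. by case: hq. Qed.

Lemma seminormZ a x : q (a *: x) = modulus a * q x.
Proof. by case: hq. Qed.

Lemma seminorm0 : q 0 = 0.
Proof. by rewrite -(scale0r 0) seminormZ modulus0 mul0r. Qed.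

Lemma seminormN x : q (- x) = q x.
Proof. by rewrite -scaleN1r seminormZ modulusN1 mul1r. Qed.

Lemma seminormB x y : q (x - y) <= q x + q y.
Proof. by rewrite -(seminormN y) seminormD. Qed.

Lemma ler_dist_seminorm x y : `|q x - q y| <= q (x - y).
Proof.
have le u v : q u - q v <= q (u - v) by rewrite lerBlDr -{1}(subrK v u) seminormD.
by rewrite ler_norml le andbT lerNl opprB -[q (x - y)]seminormN opprB le.
Qed.

(** Since [2y = (x + y) - (x - y)], at least one of [x + y] and [x - y] has seminorm no smaller than
    [y]. This recentres a large value from the origin to [x]. *)
Lemma seminorm_le_sub x y : q (x + y) <= q y -> q y <= q (x - y).
Proof.
have key : q y + q y <= q (x + y) + q (x - y).
  have -> : q y + q y = q (y + y).
    by rewrite -!mulr2n -[in RHS]scaler_nat seminormZ modulus_nat mulr_natl.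
  apply: le_trans (seminormB _ _).
  by rewrite opprB [X in _ <= q X]addrC addrA subrK.
lra.
Qed.

End Seminorm.

(** * Fréchet spaces and the uniform boundedness principle *)

Section FrechetSpace.
Variables (R : realType) (s : scalar_kind) (X : tvsType (scalar_field R s)).
Variables (p : nat -> X -> R) (hp : increasing_seminorms p).

Lemma increasing_seminorm k : is_seminorm (p k).
Proof. by case: hp. Qed.

Lemma le_increasing_seminorm k l x : (k <= l)%N -> p k x <= p l x.
Proof.
case: hp => _ pS _ /subnK <-; elim: (l - k)%N => [//|m /le_trans]; apply.
by rewrite addSn pS.
Qed.

(** By monotonicity, the seminorm of largest index dominates a finite family. Halving the radius
    gives closed balls, which keep limits of their points. *)
Lemma nbhs_seminormP x (A : set X) :
  nbhs x A <-> exists k r, 0 < r /\ [set y | p k (y - x) <= r] `<=` A.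
Proof.
case: hp => _ _ top; rewrite (top x A).
split=> [[ks [r [r0 sub]]]|[k [r [r0 sub]]]].
  exists (\max_(i <- ks) i), (r / 2); split; first by rewrite divr_gt0.
  move=> y /= yle; apply: sub => k kin.
  have /(le_increasing_seminorm (y - x)) kle : (k <= \max_(i <- ks) i)%N.
    exact: leq_bigmax_seq.
  by apply: le_lt_trans kle _; apply: le_lt_trans yle _; lra.
exists [:: k], r; split=> // y /= lt; apply: sub; apply: ltW; apply: lt.
by rewrite inE.
Qed.

Lemma seminorm_ball_nbhs x k r : 0 < r -> nbhs x [set y | p k (y - x) <= r].
Proof. by move=> r0; apply/nbhs_seminormP; exists k, r; split=> // y. Qed.

Lemma increasing_seminorm_continuous k : continuous (p k).
Proof.
move=> x; apply/cvgrPdist_le => r r0; near=> y.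
rewrite distrC; apply: le_trans (ler_dist_seminorm (increasing_seminorm k) _ _) _.
near: y; exact: seminorm_ball_nbhs.
Unshelve. all: by end_near. Qed.

(** For fixed [k] and [N >= k], the tail after [N] stays within [1/(N+1)] of [y N] for [p N], hence
    for [p k]; so the sequence is Cauchy for every seminorm. *)
Lemma seminorm_complete (y : nat -> X) :
  complete_tvs X ->
  (forall n m, (n <= m)%N -> p n (y m - y n) <= n.+1%:R^-1) ->
  exists x : X, y @ \oo --> x.
Proof.
move=> complete cauchy; apply: (complete (y @ \oo)) => U.
move=> /nbhs_seminormP [k [r0 [r0_gt0 sub]]].
near \oo => N.
have kN : (k <= N)%N by near: N; exact: nbhs_infty_ge.
have close m : (N <= m)%N -> p k (y m - y N) <= r0 / 2.
  move=> Nm; apply: le_trans (le_increasing_seminorm _ kN) _.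
  apply: le_trans (cauchy _ _ Nm) _; apply: ltW; near: N.
  have r2_gt0 : 0 < r0 / 2 by rewrite divr_gt0.
  exact: (near_infty_natSinv_lt (PosNum r2_gt0)).
exists ([set y m | m in [set m | (N <= m)%N]],
        [set y m | m in [set m | (N <= m)%N]]).
  by split; exists N => // m Nm; exists m.
case=> _ _ /= [[m Nm <-] [m' Nm' <-]]; apply: sub => /=.
rewrite subr0 -(subrKA (y N)).
apply: le_trans (seminormD (increasing_seminorm k) _ _) _.
rewrite -[p k (y N - _)](seminormN (increasing_seminorm k)) opprB.
by rewrite [r0]splitr lerD// close.
Unshelve. all: by end_near. Qed.

(* Nested balls: [n < q i] on the n-th ball, so that a point common to all balls
   would contradict pointwise boundedness. *)
Lemma uniform_boundedness (I : Type) (q : I -> X -> R) :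
  complete_tvs X ->
  (forall i, is_seminorm (q i)) -> (forall i, continuous (q i)) ->
  (forall x, exists C, forall i, q i x <= C) ->
  exists k r C, 0 < r /\ forall x, p k x <= r -> forall i, q i x <= C.
Proof.
move=> complete hq q_cont q_bounded; apply: contrapT => unbounded.
(* [nu] is a stage number with a ball, stored as centre, seminorm index and radius; [u] is the next
   ball. *)
have step (nu : nat * (X * nat * R)) : exists u : X * nat * R, 0 < nu.2.2 ->
    [/\ 0 < u.2 <= nu.1.+1%:R^-1, (nu.1 <= u.1.2)%N,
        (forall y, p u.1.2 (y - u.1.1) <= u.2 ->
                   p nu.2.1.2 (y - nu.2.1.1) <= nu.2.2) &
        forall y, p u.1.2 (y - u.1.1) <= u.2 -> exists i, nu.1%:R < q i y].
  case: nu => n [[x k] r] /=.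
  (* For a nonpositive radius the premise fails, so any witness serves; this makes the step total,
     as [choice] requires. *)
  have [r0|] := boolP (0 < r); last by exists (x, k, r).
  have [z [i [zr qz]]] : exists z i, p k z <= r / 2 /\ n%:R < q i z.
    apply: contrapT => none; apply: unbounded; exists k, (r / 2), n%:R.
    split; first by rewrite divr_gt0.
    move=> z zr i; rewrite leNgt; apply/negP => qz; apply: none.
    by exists z, i.
  have [z' [pz' qz']] : exists z', p k z' <= r / 2 /\ n%:R < q i (x + z').
    have [qz'|qz'] := leP (q i z) (q i (x + z)).
      by exists z; split=> //; apply: lt_le_trans qz'.
    exists (- z); rewrite (seminormN (increasing_seminorm k)); split=> //.
    apply: lt_le_trans qz _; exact: seminorm_le_sub (ltW qz').
  have : nbhs (x + z') [set y | n%:R < q i y].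
    by move: (q_cont i (x + z')) => /cvgr_gt; apply.
  move=> /nbhs_seminormP [k' [r' [r'0 sub]]].
  (* The index dominates [k] and [k'], and reaches [n] so that every seminorm is eventually
     controlled. Radius [r / 2] keeps the ball in the old one, [r'] keeps [q i] above [n], and
     [1/(n+1)] makes the centres Cauchy. *)
  exists (x + z', maxn n (maxn k k'),
          Num.min (Num.min (r / 2) r') n.+1%:R^-1) => _ /=.
  split.
  - by rewrite ge_min lexx orbT !lt_min r'0 divr_gt0//= invr_gt0 ltr0n.
  - exact: leq_maxl.
  - move=> y; rewrite !le_min => /andP[/andP[yr _] _].
    rewrite -(subrK (x + z') y) -addrA [x + z']addrC addrK.
    apply: le_trans (seminormD (increasing_seminorm k) _ _) _.
    rewrite [r]splitr lerD// [z' + x]addrC; apply: le_trans yr.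
    by apply: le_increasing_seminorm; rewrite !leq_max leqnn orbT.
  - move=> y; rewrite !le_min => /andP[/andP[_ yr] _]; exists i; apply: sub => /=.
    apply: le_trans yr.
    by apply: le_increasing_seminorm; rewrite !leq_max leqnn !orbT.
have [f fP] := choice step.
pose u := fix u n := if n is m.+1 then f (m, u m) else (0 : X, 0%N, 1 : R).
have u_gt0 n : 0 < (u n).2.
  elim: n => [|n IH] /=; first exact: ltr01.
  by case: (fP (n, u n) IH) => /andP[].
pose B n := [set y | p (u n).1.2 (y - (u n).1.1) <= (u n).2].
have center n : B n (u n).1.1.
  by rewrite /B /= subrr (seminorm0 (increasing_seminorm _)) ltW.
have nested n m : (n <= m)%N -> B m `<=` B n.
  move=> /subnK <-; elim: (m - n)%N => [|d IH] y; first by rewrite add0n.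
  rewrite addSn => By; apply: IH.
  by case: (fP ((d + n)%N, u (d + n)%N) (u_gt0 _)) => _ _ + _; apply.
(* Ball [n.+1] is the first with index at least [n] and radius at most [1/(n+1)], hence the shift by
   one. *)
pose y n := (u n.+1).1.1.
have [x yx] : exists x : X, y @ \oo --> x.
  apply: (seminorm_complete complete) => n m nm.
  have := nested n.+1 m.+1 nm _ (center m.+1).
  case: (fP (n, u n) (u_gt0 n)) => /andP[_ rn] kn _ _ Bm.
  apply: le_trans rn; apply: le_trans Bm.
  exact: le_increasing_seminorm kn.
(* Each ball is closed and contains all later centres, so it contains their limit. *)
have xB n : B n x.
  apply/ler_addgt0Pr => eps eps0; near \oo => m.
  have nm : (n <= m.+1)%N by apply: leqW; near: m; exact: nbhs_infty_ge.
  rewrite -(subrKA (y m)) addrC.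
  apply: le_trans (seminormD (increasing_seminorm _) _ _) _.
  rewrite lerD//; first exact: (nested n m.+1 nm _ (center m.+1)).
  rewrite -(seminormN (increasing_seminorm _)) opprB; near: m.
  exact: yx (seminorm_ball_nbhs _ _ eps0).
have [C qC] := q_bounded x.
have [n Cn] : exists n : nat, C <= n%:R.
  exists (Num.Def.archi_bound `|C|); apply: le_trans (ler_norm C) _; apply: ltW.
  exact: archi_boundP.
have [_ _ _ big_on_ball] := fP (n, u n) (u_gt0 n).
case: (big_on_ball x (xB n.+1)) => i qi.
by move: qi; rewrite ltNge (le_trans (qC i)).
Unshelve. all: by end_near. Qed.

End FrechetSpace.

(** * Bounded half-orbits and expansivity *)

Lemma bounded_eventually (R : realType) (f : nat -> R) (N : nat) (C : R) :
  (forall n, (N <= n)%N -> f n <= C) -> exists B, forall n, f n <= B.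
Proof.
elim: N C => [|N IH] C fC; first by exists C => n; apply: fC.
apply: (IH (Num.max C (f N))) => n; rewrite leq_eqVlt => /predU1P[<-|/fC le].
  by rewrite le_max lexx orbT.
by rewrite le_max le.
Qed.

Definition bounded_orbit (R : realType) (X : Type) (q : X -> R) (T : X -> X)
  (x : X) := exists B, forall m, q (iter m T x) <= B.

Section BoundedOrbit.
Variables (R : realType) (X : Type) (q : X -> R).

Lemma bounded_orbit_iter (T : X -> X) (m : nat) (x : X) :
  bounded_orbit q T (iter m T x) <-> bounded_orbit q T x.
Proof.
split=> [[B qB]|[B qB]]; last by exists B => n; rewrite -iterD.
apply: (@bounded_eventually _ _ m B) => n mn.
by rewrite -(subnK mn) iterD.
Qed.

(** The supremum starts at [n = 1] and [bounded_orbit] at [m = 0]; one extra term does not affect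
    boundedness. *)
Lemma sup_orbitP (T : X -> X) (x : X) :
  ereal_sup [set (q (iter n T x))%:E | n in [set n | (0 < n)%N]] = +oo%E <->
  ~ bounded_orbit q T x.
Proof.
rewrite ereal_sup_EFinP; last by exists 1%N.
split=> unbounded [B qB]; apply: unbounded; first by exists B.
exact: (@bounded_eventually _ _ 1 B).
Qed.

End BoundedOrbit.

Lemma positively_expansiveP (R : realType) (K : numFieldType) (X : tvsType K)
    (p : nat -> X -> R) (T : X -> X) :
  topologically_positively_expansive p T <->
  forall x, x != 0 -> exists k, ~ bounded_orbit (p k) T x.
Proof.
by split=> exp x /exp [k /sup_orbitP]; exists k => //; apply/sup_orbitP.
Qed.

Lemma expansiveP (R : realType) (K : numFieldType) (X : tvsType K)
    (p : nat -> X -> R) (T : invertible_operator X) :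
  topologically_expansive p T <->
  forall x, x != 0 -> exists k,
    ~ (bounded_orbit (p k) T x /\ bounded_orbit (p k) (op_inv T) x).
Proof.
have supP k x : ereal_sup [set (p k (op_pow T n x))%:E | n in [set: int]] = +oo%E
    <-> ~ (bounded_orbit (p k) T x /\ bounded_orbit (p k) (op_inv T) x).
  rewrite ereal_sup_EFinP; last by exists 0.
  split=> unbounded; last first.
    case=> B pB; apply: unbounded; split.
      by exists B => m; exact: (pB m%:Z).
    apply: (@bounded_eventually _ _ 1 B) => -[//|m] _.
    exact: (pB (Negz m)).
  case=> -[B pB] [C pC]; apply: unbounded; exists (Num.max B C) => -[m|m] _.
    by rewrite le_max pB.
  by rewrite le_max (pC m.+1) orbT.
by split=> exp x /exp [k /supP]; exists k => //; apply/supP.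
Qed.

(** * Coordinates and basis expansions *)

Section SequenceSpace.
Variables (R : realType) (s : scalar_kind)
  (S : pred (int -> scalar_field R s)) (X : subTvsType S).
Variables (hX : frechet_sequence_space X) (e : int -> X) (he : canonical_basis e).
Variables (p : nat -> X -> R) (hp : increasing_seminorms p).

Local Notation "x @_ n" := ((\val (x : X) : int -> scalar_field R s) n)
  (at level 9, n at level 2).

Lemma coordinate_continuous n : continuous (fun x : X => x @_ n).
Proof.
case: hX => _ _ val_continuous x.
exact: (continuous_comp (val_continuous x) (@proj_continuous _ _ n _)).
Qed.

Lemma coordinateP (x y : X) : (forall n, x @_ n = y @_ n) -> x = y.
Proof. by move=> xy; apply/val_inj/funext. Qed.

Lemma coordinateZ a (x : X) n : (a *: x) @_ n = a * x @_ n.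
Proof. by rewrite linearZ. Qed.

Lemma canonicalE j n : (e j) @_ n = (n == j)%:R.
Proof. by rewrite (he.1 j). Qed.

(** A term far out is the difference of two partial sums, each within 1 of [x], hence the bound 2.
    The two ends are moved separately, the other one staying fixed. *)
Lemma basis_terms_bounded k x : exists C, forall n, p k (x @_ n *: e n) <= C.
Proof.
have [[A1 A2] [/= [M _ MA] [N _ NA]]] :=
  he.2 x _ (seminorm_ball_nbhs hp x k ltr01).
move=> /= near_x.
pose sum m n := \sum_(0 <= i < (m + n).+1) x @_ (i%:Z - m%:Z) *: e (i%:Z - m%:Z).
have close m n m' n' : (M <= m)%N -> (N <= n)%N -> (M <= m')%N -> (N <= n')%N ->
    p k (sum m n - sum m' n') <= 2.
  move=> Mm Nn Mm' Nn'; rewrite -(subrKA x).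
  apply: le_trans (seminormD (increasing_seminorm hp k) _ _) _.
  rewrite -[p k (x - _)](seminormN (increasing_seminorm hp k)) opprB.
  rewrite -[2]/(1 + 1) lerD//.
    by apply: (near_x (m, n)); split; [exact: MA | exact: NA].
  by apply: (near_x (m', n')); split; [exact: MA | exact: NA].
have [B pB] : exists B, forall n : nat, p k (x @_ n%:Z *: e n%:Z) <= B.
  apply: (@bounded_eventually _ _ N.+1 2) => -[//|n] Nn.
  have := close M n.+1 M n (leqnn _) (ltnW Nn) (leqnn _) Nn.
  rewrite /sum addnS big_nat_recr//= addrAC subrr add0r.
  by rewrite -addnS PoszD addrAC subrr add0r.
have [C pC] : exists C, forall n : nat, p k (x @_ (- n%:Z) *: e (- n%:Z)) <= C.
  apply: (@bounded_eventually _ _ M.+1 2) => -[//|n] Mn.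
  have := close n.+1 N n N (ltnW Mn) (leqnn _) Mn (leqnn _).
  rewrite /sum addSn big_nat_recl//= sub0r.
  (* Lowering the left end shifts the indexing by one; after the first term is split off, the other
     summands are realigned so that they cancel. *)
  under eq_bigr => i _ do
    rewrite -[i.+1]addn1 -[n.+1]addn1 !PoszD opprD addrACA subrr addr0.
  by rewrite addrK.
exists (Num.max B C) => -[n|n]; first by rewrite le_max pB.
by rewrite NegzE le_max pC orbT.
Qed.

(* The coordinate projections are pointwise bounded because the terms of a basis
   expansion tend to 0; uniform boundedness makes them equicontinuous. *)
Lemma basis_projections_equicontinuous k :
  exists l, forall B, exists C, forall x, p l x <= B ->
    forall n, p k (x @_ n *: e n) <= C.
Proof.
pose q (n : int) (x : X) := p k (x @_ n *: e n).
have hpk := increasing_seminorm hp k.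
have [l [r [C [r0 qC]]]] : exists l r C, 0 < r /\
    forall x, p l x <= r -> forall n, q n x <= C.
  apply: (uniform_boundedness hp); first by case: hX.
  - move=> n; split=> [x|x y|a x]; rewrite /q.
    + exact: seminorm_ge0 hpk _.
    + by rewrite raddfD scalerDl; exact: seminormD hpk _ _.
    + by rewrite coordinateZ -scalerA; exact: seminormZ hpk _ _.
  - move=> n x.
    apply: (@continuous_comp _ _ _ (fun y : X => y @_ n *: e n) (p k)); last first.
      exact: increasing_seminorm_continuous.
    apply: (@cvg_comp2 _ _ _ _ _ (nbhs (x @_ n : (scalar_field R s)^o)) (nbhs (e n))
        _ _ _ _ (fun y : X => y @_ n)
        (fun=> e n) (fun a z => a *: z)).
    + exact: coordinate_continuous.
    + exact: cvg_cst.
    + exact: (@scale_continuous _ X (x @_ n, e n)).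
  - exact: basis_terms_bounded.
exists l => B.
(* [N] is chosen with [B <= N * r], so that [x / N] lies in the ball of radius [r]. A natural number
   is a scalar of either field with known modulus. *)
pose N := (Num.Def.archi_bound (`|B| / r)).+1.
have NB : B <= N%:R * r.
  rewrite -ler_pdivrMr//; apply: (@le_trans _ _ (`|B| / r)).
    by rewrite ler_pM2r ?invr_gt0 ?ler_norm.
  apply/ltW/(lt_le_trans (archi_boundP (divr_ge0 (normr_ge0 B) (ltW r0)))).
  by rewrite ler_nat.
have N0 : (N%:R : R) != 0 by rewrite pnatr_eq0.
exists (N%:R * C) => x xB n.
have /qC /(_ n) : p l (N%:R^-1 *: x) <= r.
  rewrite (seminormZ (increasing_seminorm hp l)) modulusV modulus_nat.
  by rewrite ler_pdivrMl ?ltr0n// (le_trans xB).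
rewrite /q coordinateZ -scalerA (seminormZ hpk) modulusV modulus_nat.
by rewrite ler_pdivrMl ?ltr0n.
Qed.

(** * Weighted shifts by [d], covering both the forward shift and its inverse *)

Section GeneralizedShift.
Variables (T : X -> X) (d : int) (v : int -> scalar_field R s).
Hypothesis (hT : forall x n, (T x) @_ (n + d) = v n * x @_ n).

Lemma shift_iterE m x n :
  (iter m T x) @_ (n + d * m%:Z) = (\prod_(0 <= i < m) v (n + d * i%:Z)) * x @_ n.
Proof.
elim: m => [|m IH]; first by rewrite mulr0 addr0 big_nil mul1r.
rewrite iterS -addn1 PoszD mulrDr mulr1 addrA hT IH addn1 big_nat_recr//=.
by rewrite mulrCA mulrA.
Qed.

(** [T] is a bare function, as [op_inv] is; homogeneity is read off the coordinates. *)
Lemma shift_iter_scale m a x : iter m T (a *: x) = a *: iter m T x.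
Proof.
apply: coordinateP => n; rewrite -(subrK (d * m%:Z) n) shift_iterE.
by rewrite !coordinateZ shift_iterE mulrCA.
Qed.

Lemma shift_iter_canonical m j :
  iter m T (e j) = (\prod_(0 <= i < m) v (j + d * i%:Z)) *: e (j + d * m%:Z).
Proof.
apply: coordinateP => n; rewrite -(subrK (d * m%:Z) n) shift_iterE coordinateZ.
rewrite !canonicalE subrK -subr_eq.
by case: eqP => [<-|_]; rewrite ?mulr0.
Qed.

Lemma bounded_orbit_scale k a x : a != 0 ->
  bounded_orbit (p k) T (a *: x) <-> bounded_orbit (p k) T x.
Proof.
have scale b y : bounded_orbit (p k) T y -> bounded_orbit (p k) T (b *: y).
  case=> B pB; exists (modulus b * B) => m.
  rewrite shift_iter_scale (seminormZ (increasing_seminorm hp k)).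
  by rewrite ler_wpM2l ?modulus_ge0.
move=> a0; split; last exact: scale.
by move=> /(scale a^-1); rewrite scalerA mulVf// scale1r.
Qed.

(* The term of index [j + d m] of [T^m x] is [T^m (x_j e_j)]. *)
Lemma bounded_orbit_term k : exists l, forall x j,
  bounded_orbit (p l) T x -> x @_ j != 0 -> bounded_orbit (p k) T (e j).
Proof.
have [l equi] := basis_projections_equicontinuous k.
exists l => x j [B pB] xj; have [C pC] := equi B.
apply/(bounded_orbit_scale k _ xj); exists C => m.
rewrite shift_iter_scale shift_iter_canonical scalerA mulrC -shift_iterE.
exact: pC.
Qed.

(** [T^m] sends [e n] to a nonzero multiple of [e (n + d m)], and with [d = 1] or [d = -1] any two
    indices are linked by such a move. *)
Lemma bounded_orbit_canonical k i j : `|d| = 1 -> (forall n, v n != 0) ->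
  bounded_orbit (p k) T (e i) -> bounded_orbit (p k) T (e j).
Proof.
move=> d1 v0.
have dd : d * d = 1 by rewrite -expr2 -[d ^+ 2]real_normK ?num_real// d1 expr1n.
have forward n (m : nat) :
    bounded_orbit (p k) T (e (n + d * m%:Z)) <-> bounded_orbit (p k) T (e n).
  rewrite -(bounded_orbit_iter _ T m (e n)) shift_iter_canonical.
  rewrite bounded_orbit_scale//.
  by elim/big_ind: _ => // a b; rewrite mulf_eq0 negb_or => -> ->.
have jE : j = i + d * (d * (j - i)) by rewrite mulrA dd mul1r addrC subrK.
(* The sign tells which of [i] and [j] comes first along the orbit; in the negative case the orbit
   runs from [e j] to [e i]. *)
case E: (d * (j - i)) jE => [m|m] ->; first by rewrite forward.
by rewrite -(forward (i + _) m.+1) NegzE -addrA -mulrDr addNr mulr0 addr0.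
Qed.

Lemma shift_positively_expansive k : `|d| = 1 -> (forall n, v n != 0) ->
  ~ bounded_orbit (p k) T (e 1) -> topologically_positively_expansive p T.
Proof.
move=> d1 v0 unbounded; apply/positively_expansiveP => x x0.
have [l termP] := bounded_orbit_term k; exists l => xB.
have [j xj] : exists j, x @_ j != 0.
  apply: contrapT => none; move/eqP: x0; apply; apply: coordinateP => n.
  rewrite raddf0; apply: contrapT => /eqP xn; apply: none.
  by exists n.
by apply: unbounded; apply: bounded_orbit_canonical d1 v0 (termP _ _ xB xj).
Qed.

End GeneralizedShift.
End SequenceSpace.

(** * Equivalence of the three assertions *)

Theorem theorem42 (R : realType) (s : scalar_kind)
    (S : pred (int -> scalar_field R s)) (X : subTvsType S)
    (hX : frechet_sequence_space X)
    (e : int -> X) (he : canonical_basis e)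
    (p : nat -> X -> R) (hp : increasing_seminorms p)
    (w : int -> scalar_field R s) (hw : forall n, w n != 0)
    (Fw : invertible_operator X)
    (hFw : forall x : X, \val (Fw x) = forward_shift w (\val x)) :
  [<-> topologically_expansive p Fw;
       exists k : nat,
         ereal_sup [set (modulus (\prod_(1 <= j < n.+1) w j%:Z)
                         * p k (e (n%:Z + 1)))%:E
                   | n in [set n : nat | (0 < n)%N]] = +oo%E
         \/
         ereal_sup [set ((modulus (\prod_(0 <= j < n) w (- j%:Z)))^-1
                         * p k (e (- n%:Z + 1)))%:E
                   | n in [set n : nat | (0 < n)%N]] = +oo%E;
       topologically_positively_expansive p Fw
       \/ topologically_positively_expansive p (op_inv Fw)].
Proof.
have fw_shift x n : \val (Fw x) (n + 1) = w n * \val x n.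
  by rewrite hFw /forward_shift addrK.
(* Solving the coordinate formula of [Fw] at the preimage shows that the inverse is a shift with
   [d = -1] and weight [1 / w (n - 1)]. *)
have bw_shift x n : \val (op_inv Fw x) (n + -1) = (w (n - 1))^-1 * \val x n.
  by rewrite -{2}(op_invK Fw x) hFw /forward_shift mulKf.
(* The quantities in (ii) are the seminorms along the two half-orbits of [e 1]; the starting index 1
   makes the weights [w 1, w 2, ...] forward and [w 0, w (-1), ...] backward. *)
have fw_iter k n : modulus (\prod_(1 <= j < n.+1) w j%:Z) * p k (e (n%:Z + 1)) =
    p k (iter n Fw (e 1)).
  rewrite (shift_iter_canonical he fw_shift) (seminormZ (increasing_seminorm hp k)).
  rewrite mul1r [1 + n%:Z]addrC big_add1; congr (modulus _ * _).
  by apply: eq_bigr => j _; rewrite mul1r -addn1 PoszD addrC.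
have bw_iter k n : (modulus (\prod_(0 <= j < n) w (- j%:Z)))^-1
    * p k (e (- n%:Z + 1)) = p k (iter n (op_inv Fw) (e 1)).
  rewrite (shift_iter_canonical he bw_shift) (seminormZ (increasing_seminorm hp k)).
  rewrite mulN1r [1 - n%:Z]addrC -modulusV -prodfV; congr (modulus _ * _).
  by apply: eq_bigr => j _; rewrite mulN1r addrAC subrr add0r.
have fw_sup k : ereal_sup [set (modulus (\prod_(1 <= j < n.+1) w j%:Z)
      * p k (e (n%:Z + 1)))%:E | n in [set n : nat | (0 < n)%N]] = +oo%E <->
    ~ bounded_orbit (p k) Fw (e 1).
  by rewrite -sup_orbitP (eq_imagel (fun n _ => congr1 EFin (fw_iter k n))).
have bw_sup k : ereal_sup [set ((modulus (\prod_(0 <= j < n) w (- j%:Z)))^-1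
      * p k (e (- n%:Z + 1)))%:E | n in [set n : nat | (0 < n)%N]] = +oo%E <->
    ~ bounded_orbit (p k) (op_inv Fw) (e 1).
  by rewrite -sup_orbitP (eq_imagel (fun n _ => congr1 EFin (bw_iter k n))).
tfae.
(* Expansivity is tested on [e 1] alone: an unbounded full orbit has an unbounded half. *)
- move=> /expansiveP /(_ (e 1)) [|k unbounded].
    apply/eqP => /(congr1 (fun x : X => \val x 1)).
    by rewrite (canonicalE he) eqxx raddf0; apply/eqP; exact: oner_neq0.
  exists k; rewrite fw_sup bw_sup; apply: contrapT => none; apply: unbounded.
  by split; apply: contrapT => ?; apply: none; [left | right].
- case=> k [/fw_sup unbounded|/bw_sup unbounded]; [left | right].
    exact: (shift_positively_expansive hX he hp fw_shift (normr1 _) hw unbounded).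
  apply: (shift_positively_expansive hX he hp bw_shift (normrN1 _) _ unbounded).
  by move=> n; rewrite invr_eq0.
- move=> exp; apply/expansiveP => x x0.
  case: exp => /positively_expansiveP /(_ x x0) [k unbounded];
    by exists k => -[].
Qed.
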